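(* Let $\alpha\in(0,1)$ and let $Q^t:\mathcal M\to\mathcal M$ for $t\in[0,+\infty)$. Suppose for every $t\in(0,+\infty)$ the map $Q^t$ satisfies: (i) if $u_k\in\mathcal M$ converge to $u\in\mathcal M$ uniformly on every bounded interval, then $Q^t[u_k]\to Q^t[u]$ almost everywhere; (ii) $u_1\le u_2$ implies $Q^t[u_1]\le Q^t[u_2]$; (iii) $T_{x_0}Q^t=Q^tT_{x_0}$ for all $x_0\in\mathbb R$, where $(T_{x_0}[u])(\cdot)=u(\cdot-x_0)$; (iv) $Q^t[\alpha]=\alpha$, and for constant functions $\gamma$: $0<\gamma<\alpha$ implies $Q^t[\gamma]<\gamma$, and $\alpha<\gamma<1$ implies $\gamma<Q^t[\gamma]$. Suppose moreover: (a) $Q^t\circ Q^s=Q^{t+s}$ for all $t,s\ge0$; (b) if $t_k\ge0$, $t_k\to0$ and $u\in\mathcal M$, then $Q^{t_k}[u]\to u$ almost everywhere; (c) whenever constants $c_-,c_+$ and $\phi_-,\phi_+\in\mathcal M$ with $\phi_-(-\infty)=0$, $\phi_-(+\infty)=\alpha$, $\phi_+(-\infty)=\alpha$, $\phi_+(+\infty)=1$ satisfy $(Q^t[\phi_-])(x-c_-t)\equiv\phi_-(x)$ and $(Q^t[\phi_+])(x-c_+t)\equiv\phi_+(x)$ for all $t\ge0$, one has $c_-<c_+$. Suppose a constant $\underline c$ and $\underline\psi\in\mathcal M$ with $\underline\psi(0)=0$, $\underline\psi(+\infty)\in(\alpha,1]$ satisfy $\underline\psi(x)\le(Q^t[\underline\psi])(x-\underline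 ct)$ for all $t\ge0$, and a constant $\overline c$ and $\overline\psi\in\mathcal M$ with $\overline\psi(-\infty)\in[0,\alpha)$, $\overline\psi(0)=1$ satisfy $(Q^t[\overline\psi])(x-\overline ct)\le\overline\psi(x)$ for all $t\ge0$. Then there exist $c\in[\underline c,\overline c]$ and $\phi\in\mathcal M$ with $\phi(-\infty)=0$, $\phi(+\infty)=1$ such that $(Q^t[\phi])(x-ct)\equiv\phi(x)$ for all $t\in[0,+\infty)$.
   Context: $\mathcal M$ denotes the set of monotone nondecreasing, left continuous functions $u$ on $\mathbb R$ with $0\le u\le 1$. Constants are regarded as constant functions in $\mathcal M$. *)

(* Defs.v *)
From Stdlib Require Import Reals.
Open Scope R_scope.

Definition inM (u : R -> R) : Prop :=
  (forall x, 0 <= u x <= 1) /\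
  (forall x y, x <= y -> u x <= u y) /\
  (forall x eps, 0 < eps -> exists d, 0 < d /\
       forall y, x - d < y < x -> Rabs (u y - u x) < eps).

Definition cst (g : R) : R -> R := fun _ => g.

Definition transl (x0 : R) (u : R -> R) : R -> R := fun x => u (x - x0).

Definition lim_minf (f : R -> R) (l : R) : Prop :=
  forall eps, 0 < eps -> exists A, forall x, x < A -> Rabs (f x - l) < eps.
Definition lim_pinf (f : R -> R) (l : R) : Prop :=
  forall eps, 0 < eps -> exists A, forall x, A < x -> Rabs (f x - l) < eps.

Definition null_set (N : R -> Prop) : Prop :=
  forall eps, 0 < eps -> exists a b : nat -> R,
    (forall n, a n <= b n) /\
    (forall x, N x -> exists n, a n < x < b n) /\
    (forall n, sum_f_R0 (fun k => b k - a k) n <= eps).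

Definition cv_ae (f : nat -> R -> R) (g : R -> R) : Prop :=
  exists N, null_set N /\ forall x, ~ N x -> Un_cv (fun k => f k x) (g x).

Definition cv_loc_unif (f : nat -> R -> R) (g : R -> R) : Prop :=
  forall a b eps, 0 < eps -> exists K, forall k, (K <= k)%nat ->
    forall x, a <= x <= b -> Rabs (f k x - g x) < eps.

(* Main.v *)
Require Import Defs.
From Stdlib Require Import Reals Lra Lia Cantor IndefiniteDescription FunctionalExtensionality.
Open Scope R_scope.

(** Contract space: for a step [tau] and a small [e > 0], the monotone map
    [u |-> Q tau (u ((1 + e) .))] has a fixed point between suitable translates of [psil] and
    [psiu] (Knaster-Tarski).  Recentre it at the last points [x1 <= x2] where it is below fixed
    levels [b1 < alpha < b2].  Near [x_i] the dilation acts as the translation by [e * x_i], so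
    as [e -> 0] Helly's theorem yields waves [f1], [f2] of [Q tau] with speeds
    [c_i = lim (- e * x_i / tau)]; because the dilation contracts, [c2 <= c1].  Letting
    [tau = 2^-n -> 0] gives waves for dyadic times, hence for all times by continuity at 0.
    The limits of a wave at infinity are fixed constants, i.e. 0, [alpha] or 1, so [f1] goes
    from 0 to [alpha] or 1 and [f2] from 0 or [alpha] to 1.  If neither joined 0 to 1,
    hypothesis (c) would give [c1 < c2]. *)

(** * Monotone left continuous functions *)

Definition nondecreasing (f : R -> R) : Prop := forall x y, x <= y -> f x <= f y.

Lemma inM_nondecreasing u : inM u -> nondecreasing u.
Proof. now intros (_ & H & _). Qed.

Lemma left_continuous_le u x M :
  inM u -> (forall d, 0 < d -> u (x - d) <= M) -> u x <= M.
Proof.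
intros (_ & _ & Hl) H.
apply Rnot_lt_le; intro Hlt.
destruct (Hl x (u x - M)) as (d & Hd & Hy); [lra|].
specialize (Hy (x - d / 2) ltac:(lra)).
specialize (H (d / 2) ltac:(lra)).
apply Rabs_def2 in Hy; lra.
Qed.

(** For monotone functions, left continuity amounts to upper bounds passing from the points strictly
    left of [x] to [x]. In this form it is inherited by pointwise suprema, by which limits and fixed
    points are built below. *)
Lemma inM_intro u :
  (forall x, 0 <= u x <= 1) -> nondecreasing u ->
  (forall x M, (forall d, 0 < d -> u (x - d) <= M) -> u x <= M) -> inM u.
Proof.
intros Hb Hm Hl; split; [exact Hb|split; [exact Hm|]].
intros x eps He.
destruct (Classical_Prop.classic (exists d, 0 < d /\ u x - eps / 2 < u (x - d)))
  as [(d & Hd & Hu)|Hn].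
- exists d; split; [exact Hd|]; intros y Hy.
  assert (u (x - d) <= u y) by (apply Hm; lra).
  assert (u y <= u x) by (apply Hm; lra).
  apply Rabs_def1; lra.
- assert (u x <= u x - eps / 2); [|lra].
  apply Hl; intros d Hd; apply Rnot_lt_le; intro Hlt.
  apply Hn; exists d; auto.
Qed.

Lemma inM_cst g : 0 <= g <= 1 -> inM (cst g).
Proof.
intros Hg; apply inM_intro; unfold cst.
- auto.
- intros x y _; lra.
- intros _ M H; apply (H 1); lra.
Qed.

Lemma inM_scale u a b : 0 < a -> inM u -> inM (fun x => u (a * x + b)).
Proof.
intros Ha Hu; apply inM_intro.
- intro x; apply Hu.
- intros x y Hxy; apply inM_nondecreasing; trivial.
  apply Rplus_le_compat_r, Rmult_le_compat_l; lra.
- intros x M H; apply left_continuous_le; trivial; intros d Hd.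
  specialize (H (d / a) (Rdiv_lt_0_compat _ _ Hd Ha)).
  replace (a * x + b - d) with (a * (x - d / a) + b) by (field; lra); exact H.
Qed.

Lemma inM_dilate u a : 0 < a -> inM u -> inM (fun x => u (a * x)).
Proof.
intros Ha Hu; replace (fun x => u (a * x)) with (fun x => u (a * x + 0)).
- apply inM_scale; assumption.
- extensionality x; f_equal; ring.
Qed.

Lemma inM_shift u b : inM u -> inM (fun x => u (x + b)).
Proof.
intros Hu; replace (fun x => u (x + b)) with (fun x => u (1 * x + b)).
- apply inM_scale; [lra|exact Hu].
- extensionality x; f_equal; ring.
Qed.

Lemma inM_min u v : inM u -> inM v -> inM (fun x => Rmin (u x) (v x)).
Proof.
intros Hu Hv; apply inM_intro.
- intro x; destruct Hu as [Hu _], Hv as [Hv _].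
  specialize (Hu x); specialize (Hv x); unfold Rmin; destruct Rle_dec; lra.
- intros x y Hxy.
  pose proof (inM_nondecreasing _ Hu x y Hxy); pose proof (inM_nondecreasing _ Hv x y Hxy).
  unfold Rmin; repeat destruct Rle_dec; lra.
- intros x M H.
  destruct (Rle_dec (u x) M) as [Hx|Hx]; [apply Rle_trans with (1 := Rmin_l _ _), Hx|].
  apply Rle_trans with (1 := Rmin_r _ _).
  apply Rnot_le_lt in Hx.
  (* Here [M < u x], so [u] exceeds [M] just left of [x]; the minimum can be at most [M] there only
     through [v]. *)
  destruct Hu as (_ & Hum & Hul); destruct (Hul x (u x - M)) as (d & Hd & Hy); [lra|].
  apply left_continuous_le; trivial; intros e He.
  set (m := Rmin e (d / 2)).
  assert (0 < m /\ m <= e /\ m <= d / 2)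
    by (unfold m; repeat split; [apply Rmin_pos; lra|apply Rmin_l|apply Rmin_r]).
  specialize (H m ltac:(lra)); specialize (Hy (x - m) ltac:(lra)).
  apply Rabs_def2 in Hy.
  assert (v (x - e) <= v (x - m)) by (apply inM_nondecreasing; [trivial|lra]).
  unfold Rmin in H; destruct Rle_dec; lra.
Qed.

Lemma inM_max u v : inM u -> inM v -> inM (fun x => Rmax (u x) (v x)).
Proof.
intros Hu Hv; apply inM_intro.
- intro x; destruct Hu as [Hu _], Hv as [Hv _].
  specialize (Hu x); specialize (Hv x); unfold Rmax; destruct Rle_dec; lra.
- intros x y Hxy.
  pose proof (inM_nondecreasing _ Hu x y Hxy); pose proof (inM_nondecreasing _ Hv x y Hxy).
  unfold Rmax; repeat destruct Rle_dec; lra.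
- intros x M H; apply Rmax_lub; apply left_continuous_le; trivial; intros d Hd;
    (eapply Rle_trans; [|apply (H d Hd)]); [apply Rmax_l|apply Rmax_r].
Qed.

(** * Weak convergence of monotone functions *)

(* For a nondecreasing limit this is convergence at its continuity points. *)
Definition wcv (f : nat -> R -> R) (g : R -> R) : Prop :=
  forall x d eps, 0 < d -> 0 < eps -> exists K, forall k, (K <= k)%nat ->
    g (x - d) - eps <= f k x <= g (x + d) + eps.

(** Both limits control [f k] at the midpoint [x + d / 2], which costs each of them half of the
    shift [d]. *)
Lemma wcv_le f g h : inM g -> nondecreasing h -> wcv f g -> wcv f h ->
  forall x d, 0 < d -> g x <= h (x + d).
Proof.
intros Hg Hh Hfg Hfh x d Hd.
apply le_epsilon; intros e He.
destruct (Hfg (x + d / 2) (d / 2) (e / 2)) as [K HK]; [lra..|].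
destruct (Hfh (x + d / 2) (d / 2) (e / 2)) as [L HL]; [lra..|].
specialize (HK (K + L)%nat ltac:(lia)); specialize (HL (K + L)%nat ltac:(lia)).
replace (x + d / 2 - d / 2) with x in HK by lra.
replace (x + d / 2 + d / 2) with (x + d) in HL by lra.
lra.
Qed.

(** Left continuity removes the shift, so equality holds at every point and not only almost
    everywhere. *)
Lemma wcv_unique f g h : inM g -> inM h -> wcv f g -> wcv f h -> g = h.
Proof.
intros Hg Hh Hfg Hfh; extensionality x.
apply Rle_antisym; apply left_continuous_le; trivial; intros d Hd;
  replace x with (x - d + d) at 2 by lra; apply (wcv_le f); auto using inM_nondecreasing.
Qed.

Lemma wcv_eventually f f' g :
  (exists N, forall k, (N <= k)%nat -> forall x, f' k x = f k x) -> wcv f g -> wcv f' g.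
Proof.
intros [N HN] H x d e Hd He; destruct (H x d e Hd He) as [K HK].
exists (K + N)%nat; intros k Hk; rewrite HN by lia; apply HK; lia.
Qed.

(** Pointwise convergence of the arguments suffices: by monotonicity [f k (p k x)] lies between the
    values of [f k] at two fixed points on either side of [x + a]. *)
Lemma wcv_perturb f g p a :
  (forall k, nondecreasing (f k)) -> (forall x, Un_cv (fun k => p k x) (x + a)) ->
  wcv f g -> wcv (fun k x => f k (p k x)) (fun x => g (x + a)).
Proof.
intros Hf Hp H x d e Hd He.
destruct (Hp x (d / 2)) as [N HN]; [lra|].
destruct (H (x + a - d / 2) (d / 2) e) as [K HK]; [lra..|].
destruct (H (x + a + d / 2) (d / 2) e) as [L HL]; [lra..|].
exists (N + K + L)%nat; intros k Hk.
specialize (HN k ltac:(lia)); specialize (HK k ltac:(lia)); specialize (HL k ltac:(lia)).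
apply Rabs_def2 in HN.
replace (x + a - d / 2 - d / 2) with (x - d + a) in HK by lra.
replace (x + a + d / 2 + d / 2) with (x + d + a) in HL by lra.
pose proof (Hf k (x + a - d / 2) (p k x) ltac:(lra)).
pose proof (Hf k (p k x) (x + a + d / 2) ltac:(lra)).
lra.
Qed.

Lemma wcv_const f g : nondecreasing g -> (forall k x, f k x = g x) -> wcv f g.
Proof.
intros Hg E x d e Hd He; exists 0%nat; intros k _; rewrite E.
pose proof (Hg (x - d) x ltac:(lra)); pose proof (Hg x (x + d) ltac:(lra)); lra.
Qed.

(** * Null sets *)

(** For [a <= b], [clamp a b x - a] is the length of the part of the interval from [a] to [b] lying
    left of [x]. *)
Definition clamp (a b x : R) : R := Rmax a (Rmin x b).

Lemma clamp_mono a b x y : x <= y -> clamp a b x <= clamp a b y.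
Proof.
intros H; unfold clamp, Rmax, Rmin; repeat destruct Rle_dec; lra.
Qed.

Lemma clamp_bound a b x : a <= b -> a <= clamp a b x <= b.
Proof. intros H; unfold clamp, Rmax, Rmin; repeat destruct Rle_dec; lra. Qed.

Lemma clamp_id a b x : a <= x <= b -> clamp a b x = x.
Proof. intros H; unfold clamp, Rmax, Rmin; repeat destruct Rle_dec; lra. Qed.

(* The total length of the parts of the first intervals lying left of [x] grows at
   least at unit speed, by a supremum argument. *)
Lemma interval_cover_length (a b : nat -> R) p q : p < q ->
  (forall n, a n <= b n) -> (forall x, p <= x <= q -> exists n, a n < x < b n) ->
  exists n, q - p <= sum_f_R0 (fun k => b k - a k) n.
Proof.
intros Hpq Hab Hcov.
set (F := fun n x => sum_f_R0 (fun k => clamp (a k) (b k) x) n).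
assert (FS : forall n x, F (S n) x = F n x + clamp (a (S n)) (b (S n)) x) by reflexivity.
assert (Fmono : forall n x y, x <= y -> F n x <= F n y).
{ intros n x y Hxy; apply sum_Rle; intros k _; apply clamp_mono, Hxy. }
assert (Fn : forall n m x y, x <= y -> (n <= m)%nat -> F n y - F n x <= F m y - F m x).
{ intros n m x y Hxy Hnm; induction Hnm as [|m _ IH]; [lra|].
  pose proof (clamp_mono (a (S m)) (b (S m)) x y Hxy); rewrite !FS; lra. }
assert (Fstep : forall m x y, a m < x -> x <= y -> y < b m -> y - x <= F m y - F m x).
{ intros m x y Hx Hxy Hy; destruct m as [|m].
  - unfold F; simpl; rewrite !clamp_id; lra.
  - pose proof (Fmono m x y Hxy); rewrite !FS, (clamp_id _ _ x), (clamp_id _ _ y); lra. }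
set (E := fun x => p <= x <= q /\ exists n, x - p <= F n x - F n p).
destruct (completeness E) as [s [Hub Hlub]].
{ exists q; intros x [Hx _]; lra. }
{ exists p; split; [lra|]; exists 0%nat; lra. }
assert (Hps : p <= s) by (apply Hub; split; [lra|]; exists 0%nat; lra).
assert (Hsq : s <= q) by (apply Hlub; intros x [Hx _]; lra).
(* The interval around [s] starts left of [s], hence contains a point [x] of [E]. Adding it to the
   sum continues the unit-speed growth from [x] up to [b m], beyond [s]; this forces [s = q]. *)
destruct (Hcov s) as [m Hm]; [lra|].
assert (Hx : exists x, E x /\ a m < x).
{ apply Classical_Prop.NNPP; intro Hn.
  assert (s <= a m); [|lra].
  apply Hlub; intros x Ex; apply Rnot_lt_le; intro; apply Hn; exists x; auto. }
destruct Hx as (x & [Hx [n Hn]] & Hmx).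
assert (Hxs : x <= s) by (apply Hub; split; [exact Hx|exists n; exact Hn]).
assert (Hy : forall y, x <= y -> y < b m -> y - p <= F (n + m)%nat y - F (n + m)%nat p).
{ intros y Hxy Hy.
  pose proof (Fn n (n + m)%nat p x ltac:(lra) ltac:(lia)).
  pose proof (Fn m (n + m)%nat x y ltac:(lra) ltac:(lia)).
  pose proof (Fstep m x y ltac:(lra) ltac:(lra) ltac:(lra)); lra. }
assert (Hs : s = q).
{ apply Rle_antisym; [exact Hsq|]; apply Rnot_lt_le; intro Hlt.
  set (y := Rmin q ((s + b m) / 2)).
  assert (s < y /\ y <= q /\ y < b m).
  { pose proof (Rmin_l q ((s + b m) / 2)); pose proof (Rmin_r q ((s + b m) / 2)).
    repeat split; unfold y; [apply Rmin_glb_lt|..]; lra. }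
  assert (y <= s); [|lra].
  apply Hub; split; [lra|]; exists (n + m)%nat; apply Hy; lra. }
exists (n + m)%nat.
apply Rle_trans with (F (n + m)%nat q - F (n + m)%nat p); [apply Hy; lra|].
unfold F; rewrite <- minus_sum; apply sum_Rle; intros k _.
pose proof (clamp_bound (a k) (b k) p (Hab k)); pose proof (clamp_bound (a k) (b k) q (Hab k)); lra.
Qed.

(** Otherwise [N] contains the closed middle third of the interval, of length [(q - p) / 3], which a
    cover of total length at most [(q - p) / 6] cannot contain. *)
Lemma null_set_complement_dense N p q : null_set N -> p < q -> exists x, p < x < q /\ ~ N x.
Proof.
intros HN Hpq; apply Classical_Prop.NNPP; intro Hn.
destruct (HN ((q - p) / 6)) as (a & b & Hab & Hc & Hs); [lra|].
destruct (interval_cover_length a b (p + (q - p) / 3) (q - (q - p) / 3)) as [n Hl]; [lra|auto|..].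
- intros x Hx; apply Hc, Classical_Prop.NNPP; intro; apply Hn; exists x; split; [lra|auto].
- specialize (Hs n); lra.
Qed.

(** Points of convergence exist in both [(x - d, x)] and [(x, x + d)], and monotonicity squeezes
    [f k x] between the values there. *)
Lemma cv_ae_wcv f g : (forall k, nondecreasing (f k)) -> nondecreasing g ->
  cv_ae f g -> wcv f g.
Proof.
intros Hf Hg (N & HN & Hcv) x d e Hd He.
destruct (null_set_complement_dense N (x - d) x HN ltac:(lra)) as (y & Hy & Ny).
destruct (null_set_complement_dense N x (x + d) HN ltac:(lra)) as (z & Hz & Nz).
destruct (Hcv y Ny e He) as [K HK]; destruct (Hcv z Nz e He) as [L HL].
exists (K + L)%nat; intros k Hk.
specialize (HK k ltac:(lia)); specialize (HL k ltac:(lia)).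
apply Rabs_def2 in HK; apply Rabs_def2 in HL.
pose proof (Hf k y x ltac:(lra)); pose proof (Hf k x z ltac:(lra)).
pose proof (Hg (x - d) y ltac:(lra)); pose proof (Hg z (x + d) ltac:(lra)); lra.
Qed.

(** * Compactness *)

Lemma Un_cv_const c : Un_cv (fun _ => c) c.
Proof. intros e He; exists 0%nat; intros n _; rewrite Rdist_eq; exact He. Qed.

(** Extractions are only required to satisfy [k <= s k], without being increasing: this preserves
    limits and is stable under composition. *)
Lemma Un_cv_subseq u l s : (forall k, (k <= s k)%nat) -> Un_cv u l -> Un_cv (fun k => u (s k)) l.
Proof.
intros Hs H e He; destruct (H e He) as [K HK]; exists K; intros k Hk; apply HK.
specialize (Hs k); lia.
Qed.

Lemma bounded_convergent_subseq (u : nat -> R) a b : (forall k, a <= u k <= b) ->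
  exists s, (forall k, (k <= s k)%nat) /\ exists l, Un_cv (fun k => u (s k)) l.
Proof.
intros H.
destruct (Bolzano_Weierstrass u (fun x => a <= x <= b) (compact_P3 a b) H) as [l Hl].
destruct (functional_choice (fun k p => (k <= p)%nat /\ Rabs (u p - l) < / INR (S k))) as [s Hs].
{ intro k; apply (Hl (fun x => Rabs (x - l) < / INR (S k)) k).
  exists (mkposreal _ (Rinv_0_lt_compat _ (lt_0_INR (S k) (Nat.lt_0_succ k)))).
  intros x Hx; exact Hx. }
exists s; split; [intro k; apply Hs|]; exists l; intros e He.
destruct (archimed_cor1 e He) as (N & HN & HN0).
exists N; intros k Hk; apply Rlt_trans with (2 := HN).
apply Rlt_le_trans with (1 := proj2 (Hs k)).
apply Rinv_le_contravar; [apply lt_0_INR; lia|apply le_INR; lia].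
Qed.

Lemma diagonal_subseq (u : nat -> nat -> R) a b : (forall k j, a <= u k j <= b) ->
  exists s, (forall k, (k <= s k)%nat) /\ forall j, exists l, Un_cv (fun k => u (s k) j) l.
Proof.
intros H.
destruct (functional_choice (fun (p : nat * (nat -> nat)) r => (forall k, (k <= r k)%nat) /\
  exists l, Un_cv (fun k => u (snd p (r k)) (fst p)) l)) as [r Hr].
{ intros [j s]; apply (bounded_convergent_subseq (fun k => u (s k) j) a b); intro k; apply H. }
(* [sg j] is the result of [j] successive extractions, the one numbered [i] making coordinate [i]
   converge. *)
set (sg := fix sg j := match j with
  | O => fun k => k
  | S i => fun k => sg i (r (i, sg i) k) end).
assert (Hsg : forall i j k, exists m, (k <= m)%nat /\ sg (j + i)%nat k = sg i m).
{ intros i j; induction j as [|j IH]; intro k; [exists k; auto|].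
  simpl; destruct (IH (r ((j + i)%nat, sg (j + i)%nat) k)) as (m & Hm & E).
  exists m; split; [|exact E].
  pose proof (proj1 (Hr ((j + i)%nat, sg (j + i)%nat)) k); lia. }
exists (fun k => sg k k); split.
- intro k; destruct (Hsg 0%nat k k) as (m & Hm & E).
  rewrite Nat.add_0_r in E; rewrite E; exact Hm.
- intro j; destruct (Hr (j, sg j)) as [_ [l Hl]]; exists l; intros e He.
  destruct (Hl e He) as [K HK]; exists (K + S j)%nat; intros k Hk.
  (* For [k >= S j] the diagonal term is a term of the extraction [sg (S j)], at an index [m >= k];
     coordinate [j] converges along that extraction. *)
  destruct (Hsg (S j) (k - S j)%nat k) as (m & Hm & E).
  replace (k - S j + S j)%nat with k in E by lia.
  rewrite E; apply HK; lia.
Qed.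

(** An enumeration of the rationals: two Cantor pairings decode the triple [a], [b], [c]. *)
Definition ratio (n : nat) : R :=
  let (a, m) := Cantor.of_nat n in let (b, c) := Cantor.of_nat m in
  (INR a - INR b) / INR (S c).

Lemma ratio_dense x y : x < y -> exists n, x < ratio n < y.
Proof.
intros Hxy.
destruct (archimed_cor1 (y - x)) as (c & Hc & Hc0); [lra|].
destruct c as [|c]; [lia|].
assert (Hp : 0 < INR (S c)) by (apply lt_0_INR; lia).
set (z := up (x * INR (S c))).
destruct (archimed (x * INR (S c))) as [Hz1 Hz2]; fold z in Hz1, Hz2.
(* The numerator [z] is coded as the difference of its positive and negative parts. *)
exists (Cantor.to_nat (Z.to_nat z, Cantor.to_nat (Z.to_nat (- z), c))).
unfold ratio; rewrite !cancel_of_to.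
replace (INR (Z.to_nat z) - INR (Z.to_nat (- z))) with (IZR z).
2:{ rewrite !INR_IZR_INZ, <- minus_IZR; f_equal; lia. }
split.
- apply (Rmult_lt_reg_r (INR (S c))); [exact Hp|].
  replace (IZR z / INR (S c) * INR (S c)) with (IZR z) by (field; lra); lra.
- apply (Rmult_lt_reg_r (INR (S c))); [exact Hp|].
  replace (IZR z / INR (S c) * INR (S c)) with (IZR z) by (field; lra).
  apply (Rmult_lt_compat_r (INR (S c))) in Hc; [|exact Hp].
  rewrite Rinv_l in Hc by lra; lra.
Qed.

(** A diagonal extraction gives convergence at all rationals. The limit at [x] is defined as the
    supremum of these values over rationals strictly below [x], and the strictness makes it left
    continuous. *)
Lemma helly (f : nat -> R -> R) : (forall k, inM (f k)) ->
  exists s g, (forall k, (k <= s k)%nat) /\ inM g /\ wcv (fun k => f (s k)) g.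
Proof.
intros Hf.
destruct (diagonal_subseq (fun k j => f k (ratio j)) 0 1) as (s & Hs & Hl).
{ intros k j; apply Hf. }
destruct (functional_choice _ Hl) as [l Hcv]; clear Hl.
assert (Hl01 : forall j, 0 <= l j <= 1).
{ intro j; split.
  - apply Rnot_lt_le; intro Hlt; destruct (Hcv j (- l j)) as [K HK]; [lra|].
    specialize (HK K (le_n K)); apply Rabs_def2 in HK.
    destruct (Hf (s K)) as [B _]; specialize (B (ratio j)); lra.
  - apply Rnot_lt_le; intro Hlt; destruct (Hcv j (l j - 1)) as [K HK]; [lra|].
    specialize (HK K (le_n K)); apply Rabs_def2 in HK.
    destruct (Hf (s K)) as [B _]; specialize (B (ratio j)); lra. }
destruct (functional_choice (fun x m => is_lub (fun v => exists j, ratio j < x /\ v = l j) m)) as [g Hg].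
{ intro x; destruct (completeness (fun v => exists j, ratio j < x /\ v = l j)) as [m Hm].
  - exists 1; intros v (j & _ & ->); apply Hl01.
  - destruct (ratio_dense (x - 1) x) as [j Hj]; [lra|]; exists (l j), j; split; [lra|auto].
  - exists m; exact Hm. }
assert (Hup : forall x j, ratio j < x -> l j <= g x).
{ intros x j Hj; apply Hg; exists j; auto. }
assert (Hlub : forall x M, (forall j, ratio j < x -> l j <= M) -> g x <= M).
{ intros x M H; apply Hg; intros v (j & Hj & ->); auto. }
assert (Hmono : forall i j, ratio i <= ratio j -> l i <= l j).
{ intros i j Hij; apply Rle_cv_lim with (2 := Hcv i) (3 := Hcv j).
  intro k; apply inM_nondecreasing; auto. }
exists s, g; split; [exact Hs|split].
- apply inM_intro.
  + intro x; split.
    * destruct (ratio_dense (x - 1) x) as [j Hj]; [lra|].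
      apply Rle_trans with (l j); [apply Hl01|apply Hup; lra].
    * apply Hlub; intros j _; apply Hl01.
  + intros x y Hxy; apply Hlub; intros j Hj; apply Hup; lra.
  + intros x M H; apply Hlub; intros j Hj.
    destruct (ratio_dense (ratio j) x Hj) as [i Hi].
    apply Rle_trans with (g (ratio i)); [apply Hup; lra|].
    replace (ratio i) with (x - (x - ratio i)) by lra; apply H; lra.
- intros x d e Hd He.
  destruct (ratio_dense (x - d) x) as [i Hi]; [lra|].
  destruct (ratio_dense x (x + d)) as [j Hj]; [lra|].
  destruct (Hcv i e He) as [K HK]; destruct (Hcv j e He) as [L HL].
  exists (K + L)%nat; intros k Hk.
  specialize (HK k ltac:(lia)); specialize (HL k ltac:(lia)).
  apply Rabs_def2 in HK; apply Rabs_def2 in HL.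
  pose proof (inM_nondecreasing _ (Hf (s k)) (ratio i) x ltac:(lra)).
  pose proof (inM_nondecreasing _ (Hf (s k)) x (ratio j) ltac:(lra)).
  assert (g (x - d) <= l i) by (apply Hlub; intros n Hn; apply Hmono; lra).
  assert (l j <= g (x + d)) by (apply Hup; lra).
  lra.
Qed.

(** * A single map *)

Record wave_map (P : (R -> R) -> R -> R) : Prop := {
  wm_inM : forall u, inM u -> inM (P u);
  wm_cont : forall (uk : nat -> R -> R) u, (forall k, inM (uk k)) -> inM u ->
    cv_loc_unif uk u -> cv_ae (fun k => P (uk k)) (P u);
  wm_mono : forall u v, inM u -> inM v -> (forall x, u x <= v x) -> forall x, P u x <= P v x;
  wm_transl : forall x0 u, inM u -> forall x, P (transl x0 u) x = transl x0 (P u) x }.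

Lemma wm_shift P u b x : wave_map P -> inM u -> P (fun y => u (y + b)) x = P u (x + b).
Proof.
intros HP Hu.
assert (E : forall f, (fun y => f (y + b)) = transl (- b) f :> (R -> R)).
{ intro f; unfold transl; extensionality y; f_equal; ring. }
rewrite E, wm_transl by assumption.
unfold transl; f_equal; ring.
Qed.

(** Finitely many grid points of spacing [d / 2] suffice: the bound at a grid point extends to the
    next one by monotonicity, at the cost of the other half of [d]. *)
Lemma wcv_eventually_ge f g d a b eps : (forall k, nondecreasing (f k)) -> nondecreasing g ->
  wcv f g -> 0 < d -> 0 < eps ->
  exists K, forall k, (K <= k)%nat -> forall x, a <= x <= b -> g (x - d) - eps <= f k x.
Proof.
intros Hf Hg H Hd He.
assert (Hn : forall n, exists K, forall k, (K <= k)%nat ->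
  forall x, a <= x <= a + INR n * (d / 2) -> g (x - d) - eps <= f k x).
{ induction n as [|n [K IH]].
  - destruct (H a d eps Hd He) as [K HK]; exists K; intros k Hk x Hx.
    simpl in Hx; replace x with a by lra; apply HK, Hk.
  - destruct (H (a + INR n * (d / 2)) (d / 2) eps) as [L HL]; [lra..|].
    exists (K + L)%nat; intros k Hk x Hx; rewrite S_INR in Hx.
    destruct (Rle_dec x (a + INR n * (d / 2))) as [Hle|Hle]; [apply IH; [lia|lra]|].
    specialize (HL k ltac:(lia)).
    pose proof (Hg (x - d) (a + INR n * (d / 2) - d / 2) ltac:(lra)).
    pose proof (Hf k (a + INR n * (d / 2)) x ltac:(lra)); lra. }
destruct (INR_archimed (d / 2) (b - a)) as [n Hb]; [lra|].
destruct (Hn n) as [K HK]; exists K; intros k Hk x Hx; apply HK; [exact Hk|lra].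
Qed.

Lemma wcv_eventually_le f g d a b eps : (forall k, nondecreasing (f k)) -> nondecreasing g ->
  wcv f g -> 0 < d -> 0 < eps ->
  exists K, forall k, (K <= k)%nat -> forall x, a <= x <= b -> f k x <= g (x + d) + eps.
Proof.
intros Hf Hg H Hd He.
(* The reflection [x |-> - f (- x)] preserves monotonicity and exchanges lower and upper bounds. *)
destruct (wcv_eventually_ge (fun k x => - f k (- x)) (fun x => - g (- x)) d (- b) (- a) eps)
  as [K HK]; trivial.
- intros k x y Hxy; apply Ropp_le_contravar, Hf; lra.
- intros x y Hxy; apply Ropp_le_contravar, Hg; lra.
- intros x d' e Hd' He'; destruct (H (- x) d' e Hd' He') as [K HK]; exists K; intros k Hk.
  specialize (HK k Hk).
  replace (- (x - d')) with (- x + d') by ring; replace (- (x + d')) with (- x - d') by ring; lra.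
- exists K; intros k Hk x Hx; specialize (HK k Hk (- x) ltac:(lra)).
  replace (- (- x - d)) with (x + d) in HK by ring; rewrite Ropp_involutive in HK; lra.
Qed.

(* Truncating [u k] by the translates [u (. - d)] and [u (. + d)] of its limit turns weak
   into locally uniform convergence, and translates commute with [P]. *)
Lemma wcv_map P uk u : wave_map P -> (forall k, inM (uk k)) -> inM u -> wcv uk u ->
  wcv (fun k => P (uk k)) (P u).
Proof.
intros HP Huk Hu Hcv x d e Hd He.
assert (Hs : forall c, inM (fun y => u (y + c))) by (intro; apply inM_shift, Hu).
set (lo := fun k y => Rmin (uk k y) (u (y + - (d / 2)))).
set (hi := fun k y => Rmax (uk k y) (u (y + d / 2))).
assert (Hlo : forall k, inM (lo k)) by (intro k; apply inM_min; auto).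
assert (Hhi : forall k, inM (hi k)) by (intro k; apply inM_max; auto).
assert (Llo : wcv (fun k => P (lo k)) (P (fun y => u (y + - (d / 2))))).
{ apply cv_ae_wcv; [intro k; apply inM_nondecreasing, wm_inM; auto|
    apply inM_nondecreasing, wm_inM; auto|].
  apply wm_cont; auto; intros a b e' He'.
  (* On [[a, b]] the function [uk k] is eventually above the translate of [u], up to [e' / 2], so
     the minimum is uniformly close to this translate. *)
  destruct (wcv_eventually_ge uk u (d / 2) a b (e' / 2)) as [K HK];
    auto using inM_nondecreasing; [lra..|].
  exists K; intros k Hk y Hy; specialize (HK k Hk y Hy).
  change (u (y - d / 2)) with (u (y + - (d / 2))) in HK.
  unfold lo, Rmin; destruct Rle_dec; apply Rabs_def1; lra. }
assert (Lhi : wcv (fun k => P (hi k)) (P (fun y => u (y + d / 2)))).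
{ apply cv_ae_wcv; [intro k; apply inM_nondecreasing, wm_inM; auto|
    apply inM_nondecreasing, wm_inM; auto|].
  apply wm_cont; auto; intros a b e' He'.
  destruct (wcv_eventually_le uk u (d / 2) a b (e' / 2)) as [K HK];
    auto using inM_nondecreasing; [lra..|].
  exists K; intros k Hk y Hy; specialize (HK k Hk y Hy).
  unfold hi, Rmax; destruct Rle_dec; apply Rabs_def1; lra. }
destruct (Llo x (d / 2) e) as [K HK]; [lra..|].
destruct (Lhi x (d / 2) e) as [L HL]; [lra..|].
exists (K + L)%nat; intros k Hk.
specialize (HK k ltac:(lia)); specialize (HL k ltac:(lia)).
rewrite !wm_shift in HK, HL by assumption.
replace (x - d / 2 + - (d / 2)) with (x - d) in HK by lra.
replace (x + d / 2 + d / 2) with (x + d) in HL by lra.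
pose proof (wm_mono P HP (lo k) (uk k) (Hlo k) (Huk k) (fun y => Rmin_l _ _) x).
pose proof (wm_mono P HP (uk k) (hi k) (Huk k) (Hhi k) (fun y => Rmax_l _ _) x).
lra.
Qed.

(** Both sides of the equation converge weakly, and weak limits are unique. The factor [a k]
    accommodates dilations; the equation is asked only eventually because a dyadic time is a
    multiple of [1 / 2 ^ k] only for large [k]. *)
Lemma wave_limit P f g a b d : wave_map P -> (forall k, inM (f k)) -> inM g -> wcv f g ->
  (forall k, 0 < a k) -> Un_cv a 1 -> Un_cv b (- d) ->
  (exists N, forall k, (N <= k)%nat -> forall x, P (fun y => f k (a k * y + b k)) x = f k x) ->
  forall x, P g (x - d) = g x.
Proof.
intros HP Hf Hg Hcv Ha La Lb Hw x.
assert (Hs : inM (fun y => g (y + - d))) by (apply inM_shift, Hg).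
change (P g (x + - d) = g x); rewrite <- (wm_shift P g (- d)) by assumption.
enough (E : P (fun y => g (y + - d)) = g) by (rewrite E; reflexivity).
apply (wcv_unique (fun k => P (fun y => f k (a k * y + b k)))); trivial.
- apply wm_inM; assumption.
- apply wcv_map; trivial.
  + intro k; apply inM_scale; auto.
  + apply wcv_perturb with (p := fun k y => a k * y + b k); auto.
    * intro k; apply inM_nondecreasing, Hf.
    * intro y; apply CV_plus; [|exact Lb].
      rewrite <- (Rmult_1_l y) at 1; apply CV_mult; [exact La|apply Un_cv_const].
- apply wcv_eventually with (2 := Hcv), Hw.
Qed.

(* Knaster-Tarski: the supremum of all subsolutions below [w]. *)
Lemma contracted_fixpoint P v w e : wave_map P -> 0 < e -> inM v -> inM w ->
  (forall x, v x <= w x) ->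
  (forall x, v x <= P (fun y => v ((1 + e) * y)) x) ->
  (forall x, P (fun y => w ((1 + e) * y)) x <= w x) ->
  exists f, inM f /\ (forall x, v x <= f x <= w x) /\
    forall x, P (fun y => f ((1 + e) * y)) x = f x.
Proof.
intros HP He Hv Hw Hvw Hsub Hsup.
assert (HS : forall u, inM u -> inM (fun y => u ((1 + e) * y))).
{ intros u Hu; apply inM_dilate; [lra|exact Hu]. }
set (G := fun u => P (fun y => u ((1 + e) * y))).
assert (HG : forall u, inM u -> inM (G u)) by (intros u Hu; apply (wm_inM P HP), HS, Hu).
assert (Gmono : forall u u', inM u -> inM u' -> (forall x, u x <= u' x) ->
  forall x, G u x <= G u' x) by (intros; apply (wm_mono P HP); try apply HS; auto).
set (S := fun u => inM u /\ (forall x, u x <= w x) /\ (forall x, u x <= G u x)).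
assert (HSv : S v) by (split; auto).
destruct (functional_choice (fun x m => is_lub (fun z => exists u, S u /\ z = u x) m)) as [f Hf].
{ intro x; destruct (completeness (fun z => exists u, S u /\ z = u x)) as [m Hm].
  - exists (w x); intros z (u & (_ & Hu & _) & ->); auto.
  - exists (v x), v; auto.
  - exists m; exact Hm. }
assert (Hup : forall u x, S u -> u x <= f x).
{ intros u x Hu; apply Hf; exists u; auto. }
assert (Hlub : forall x M, (forall u, S u -> u x <= M) -> f x <= M).
{ intros x M H; apply Hf; intros z (u & Hu & ->); auto. }
assert (HfM : inM f).
{ apply inM_intro.
  - intro x; split.
    + apply Rle_trans with (v x); [apply Hv|auto].
    + apply Hlub; intros u [Hu _]; apply Hu.
  - intros x y Hxy; apply Hlub; intros u Hu; apply Rle_trans with (u y); [|auto].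
    apply inM_nondecreasing; [apply Hu|exact Hxy].
  - intros x M H; apply Hlub; intros u Hu; apply left_continuous_le; [apply Hu|].
    intros d Hd; apply Rle_trans with (f (x - d)); auto. }
assert (Hfw : forall x, f x <= w x) by (intro x; apply Hlub; intros u Hu; apply Hu).
assert (HfG : forall x, f x <= G f x).
{ intro x; apply Hlub; intros u Hu; apply Rle_trans with (G u x); [apply Hu|].
  apply Gmono; [apply Hu|exact HfM|auto]. }
exists f; split; [exact HfM|split; [auto|]].
intro x; apply Rle_antisym; [|apply HfG].
(* [G f] is itself a subsolution below [w], hence lies below the supremum [f]. *)
apply (Hup (G f)); split; [auto|split].
- intro y; apply Rle_trans with (G w y); [apply Gmono; auto|apply Hsup].
- intro y; apply Gmono; auto.
Qed.

(** * Level crossings, recentring and dilated barriers *)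

Lemma last_point_below f b : inM f -> (exists x, f x <= b) -> (exists x, b < f x) ->
  exists x0, f x0 <= b /\ forall x, x0 < x -> b < f x.
Proof.
intros Hf [p Hp] [q Hq].
assert (Hm := inM_nondecreasing _ Hf).
destruct (completeness (fun x => f x <= b)) as [x0 [Hub Hlub]].
- exists q; intros x Hx; apply Rnot_lt_le; intro Hlt; specialize (Hm q x ltac:(lra)); lra.
- exists p; exact Hp.
- exists x0; split.
  + apply left_continuous_le; [exact Hf|]; intros d Hd; apply Rnot_lt_le; intro Hlt.
    assert (x0 <= x0 - d); [|lra].
    apply Hlub; intros x Hx; apply Rnot_lt_le; intro Hlt'.
    specialize (Hm (x0 - d) x ltac:(lra)); lra.
  + intros x Hx; apply Rnot_le_lt; intro Hle; specialize (Hub x Hle); lra.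
Qed.

(** Weak inequalities away from 0 survive weak limits. They keep a recentred limit from losing the
    level [b], whatever its value at 0. *)
Definition crosses (b : R) (u : R -> R) : Prop :=
  (forall y, y < 0 -> u y <= b) /\ (forall y, 0 < y -> b <= u y).

Lemma crosses_wcv f g b : (forall k, crosses b (f k)) -> wcv f g -> crosses b g.
Proof.
intros Hf Hcv; split; intros y Hy; apply le_epsilon; intros e He.
- destruct (Hcv (y / 2) (- y / 2) e) as [K HK]; [lra..|].
  specialize (HK K (le_n K)); replace (y / 2 - - y / 2) with y in HK by lra.
  pose proof (proj1 (Hf K) (y / 2) ltac:(lra)); lra.
- destruct (Hcv (y / 2) (y / 2) e) as [K HK]; [lra..|].
  specialize (HK K (le_n K)); replace (y / 2 + y / 2) with y in HK by lra.
  pose proof (proj2 (Hf K) (y / 2) ltac:(lra)); lra.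
Qed.

(* Near [x k] the dilation by [1 + e k] is almost the translation by [e k * x k]. *)
Lemma recentered_limit P f x e b d : wave_map P -> (forall k, inM (f k)) ->
  (forall k, 0 < e k) -> Un_cv e 0 -> Un_cv (fun k => e k * x k) (- d) ->
  (forall k y, P (fun z => f k ((1 + e k) * z)) y = f k y) ->
  (forall k, f k (x k) <= b /\ forall y, x k < y -> b < f k y) ->
  exists g, inM g /\ crosses b g /\ forall y, P g (y - d) = g y.
Proof.
intros HP Hf He Le Lx Hfix Hb.
destruct (helly (fun k y => f k (y + x k))) as (s & g & Hs & Hg & Hcv).
{ intro k; apply inM_shift, Hf. }
exists g; split; [exact Hg|split].
- apply crosses_wcv with (2 := Hcv); intro k; destruct (Hb (s k)) as [H1 H2]; split; intros y Hy.
  + apply Rle_trans with (2 := H1), inM_nondecreasing; [apply Hf|lra].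
  + apply Rlt_le, H2; lra.
- apply wave_limit with (f := fun k y => f (s k) (y + x (s k)))
    (a := fun k => 1 + e (s k)) (b := fun k => e (s k) * x (s k)); trivial.
  + intro k; apply inM_shift, Hf.
  + intro k; specialize (He (s k)); lra.
  + pose proof (CV_plus _ _ _ _ (Un_cv_const 1) (Un_cv_subseq e 0 s Hs Le)) as L.
    rewrite Rplus_0_r in L; exact L.
  + apply (Un_cv_subseq (fun k => e k * x k)), Lx; exact Hs.
  + exists 0%nat; intros k _ y.
    (* In the recentred variable, [(1 + e) * (y + x) = ((1 + e) * y + e * x) + x]. *)
    rewrite <- (Hfix (s k) (y + x (s k))), <- wm_shift; trivial.
    * f_equal; extensionality z; f_equal; ring.
    * apply inM_dilate; [specialize (He (s k)); lra|apply Hf].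
Qed.

(** The shift [h = (1 + e) * d / e] makes two cases meet. If [- d <= e * y], then
    [y + h - d <= (1 + e) * y + h] and monotonicity applies; otherwise
    [e * (y + h - d) = e * y + d < 0], and [v] vanishes left of 0. *)
Lemma dilated_subsolution P v d e : wave_map P -> 0 < e -> inM v -> v 0 = 0 ->
  (forall x, v x <= P v (x - d)) ->
  forall x, v (x + (1 + e) * d / e) <= P (fun y => v ((1 + e) * y + (1 + e) * d / e)) x.
Proof.
intros HP He Hv V0 Hd x; set (h := (1 + e) * d / e).
apply Rle_trans with (1 := Hd _).
replace (x + h - d) with (x + (h - d)) by ring.
rewrite <- wm_shift by assumption.
apply wm_mono; trivial; [apply inM_shift, Hv|apply inM_scale; [lra|exact Hv]|].
intro y; assert (Hh : e * h = (1 + e) * d) by (unfold h; field; lra).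
destruct (Rle_dec (- d) (e * y)) as [Hy|Hy].
- apply inM_nondecreasing; [exact Hv|lra].
- apply Rle_trans with (v 0).
  + apply inM_nondecreasing; [exact Hv|].
    apply (Rmult_le_reg_l e); [exact He|].
    replace (e * (y + (h - d))) with (e * y + e * h - e * d) by ring; rewrite Hh, Rmult_0_r; lra.
  + rewrite V0; apply Hv.
Qed.

(** The mirror argument, in which [w] equals 1 right of 0. *)
Lemma dilated_supersolution P w d e : wave_map P -> 0 < e -> inM w -> w 0 = 1 ->
  (forall x, P w (x - d) <= w x) ->
  forall x, P (fun y => w ((1 + e) * y + (1 + e) * d / e)) x <= w (x + (1 + e) * d / e).
Proof.
intros HP He Hw W0 Hd x; set (h := (1 + e) * d / e).
apply Rle_trans with (2 := Hd _).
replace (x + h - d) with (x + (h - d)) by ring.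
rewrite <- (wm_shift P w) by assumption.
apply wm_mono; trivial; [apply inM_scale; [lra|exact Hw]|apply inM_shift, Hw|].
intro y; assert (Hh : e * h = (1 + e) * d) by (unfold h; field; lra).
destruct (Rle_dec (e * y) (- d)) as [Hy|Hy].
- apply inM_nondecreasing; [exact Hw|lra].
- apply Rle_trans with (w 0).
  + rewrite W0; apply Hw.
  + apply inM_nondecreasing; [exact Hw|].
    apply (Rmult_le_reg_l e); [exact He|].
    replace (e * (y + (h - d))) with (e * y + e * h - e * d) by ring; rewrite Hh, Rmult_0_r; lra.
Qed.

(** * Two waves of a single map *)

Lemma Un_cv_inv_S : Un_cv (fun k => / INR (S k)) 0.
Proof.
intros e He; destruct (archimed_cor1 e He) as (N & HN & HN0).
exists N; intros k Hk; unfold Rdist; rewrite Rminus_0_r, Rabs_pos_eq.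
- apply Rle_lt_trans with (2 := HN), Rinv_le_contravar; [apply lt_0_INR; lia|apply le_INR; lia].
- apply Rlt_le, Rinv_0_lt_compat, lt_0_INR; lia.
Qed.

Lemma Un_cv_affine e p q : Un_cv e 0 -> Un_cv (fun k => e k * p + q) q.
Proof.
intros He.
pose proof (CV_plus _ _ _ _ (CV_mult _ _ _ _ He (Un_cv_const p)) (Un_cv_const q)) as L.
rewrite Rmult_0_l, Rplus_0_l in L; exact L.
Qed.

(** Since [b1 <= b2], the last points satisfy [x1 <= x2]. The displacements are limits of
    [- e k * x1 k] and [- e k * x2 k], and the sign reverses the order: [d2 <= d1]. *)
Lemma two_waves P v w dl du b1 b2 xl xu : wave_map P -> inM v -> inM w ->
  v 0 = 0 -> w 0 = 1 -> b1 <= b2 -> b2 < v xl -> w xu <= b1 -> dl <= du ->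
  (forall x, v x <= P v (x - dl)) -> (forall x, P w (x - du) <= w x) ->
  exists d1 d2 f1 f2, dl <= d2 /\ d2 <= d1 /\ d1 <= du /\
    (inM f1 /\ crosses b1 f1 /\ forall x, P f1 (x - d1) = f1 x) /\
    (inM f2 /\ crosses b2 f2 /\ forall x, P f2 (x - d2) = f2 x).
Proof.
intros HP Hv Hw V0 W0 Hb Hxl Hxu Hd Hsub Hsup.
set (e := fun k => / INR (S k)).
assert (He : forall k, 0 < e k <= 1).
{ intro k; unfold e; split; [apply Rinv_0_lt_compat, lt_0_INR; lia|].
  rewrite <- Rinv_1; apply Rinv_le_contravar; [lra|]; rewrite S_INR; pose proof (pos_INR k); lra. }
assert (Le : Un_cv e 0) by apply Un_cv_inv_S.
(* [p] packs the fixed point with [x1] and [x2]. The barriers give [xu - hu <= x1 <= x2 <= xl - hl];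
   multiplied by [e k], the outer terms stay bounded and tend to [- du] and [- dl]. *)
assert (Hk : forall k, exists p : (R -> R) * (R * R), inM (fst p) /\
  (forall y, P (fun z => fst p ((1 + e k) * z)) y = fst p y) /\
  (fst p (fst (snd p)) <= b1 /\ forall y, fst (snd p) < y -> b1 < fst p y) /\
  (fst p (snd (snd p)) <= b2 /\ forall y, snd (snd p) < y -> b2 < fst p y) /\
  e k * xu - (1 + e k) * du <= e k * fst (snd p) /\
  e k * fst (snd p) <= e k * snd (snd p) <= e k * xl - (1 + e k) * dl).
{ intro k; specialize (He k); destruct He as [He He1]; set (ek := e k) in *.
  set (hl := (1 + ek) * dl / ek); set (hu := (1 + ek) * du / ek).
  assert (Hhl : ek * hl = (1 + ek) * dl) by (unfold hl; field; lra).
  assert (Hhu : ek * hu = (1 + ek) * du) by (unfold hu; field; lra).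
  assert (Hh : hl <= hu).
  { unfold hl, hu, Rdiv; apply Rmult_le_compat_r; [apply Rlt_le, Rinv_0_lt_compat, He|].
    apply Rmult_le_compat_l; lra. }
  destruct (contracted_fixpoint P (fun x => v (x + hl)) (fun x => w (x + hu)) ek)
    as (f & Hf & Hvfw & Hfix); trivial; try (apply inM_shift; assumption).
  (* As [hl <= hu], the barriers can be compared at the same point [x + hu]: left of 0 [v] vanishes,
     right of 0 [w] equals 1. *)
  { intro x; apply Rle_trans with (v (x + hu)); [apply inM_nondecreasing; [exact Hv|lra]|].
    destruct (Rle_dec (x + hu) 0) as [Hx|Hx].
    - apply Rle_trans with (v 0); [apply inM_nondecreasing; assumption|rewrite V0; apply Hw].
    - apply Rle_trans with (w 0); [rewrite W0; apply Hv|apply inM_nondecreasing; [exact Hw|lra]]. }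
  { apply dilated_subsolution; assumption. }
  { apply dilated_supersolution; assumption. }
  pose proof (inM_nondecreasing _ Hf) as Hm.
  assert (Hlow : f (xu - hu) <= b1).
  { apply Rle_trans with (1 := proj2 (Hvfw _)); replace (xu - hu + hu) with xu by ring; exact Hxu. }
  assert (Hhigh : b2 < f (xl - hl)).
  { apply Rlt_le_trans with (2 := proj1 (Hvfw _)); replace (xl - hl + hl) with xl by ring; exact Hxl. }
  destruct (last_point_below f b1 Hf) as (x1 & H1 & H1').
  { exists (xu - hu); exact Hlow. } { exists (xl - hl); lra. }
  destruct (last_point_below f b2 Hf) as (x2 & H2 & H2').
  { exists (xu - hu); lra. } { exists (xl - hl); exact Hhigh. }
  assert (xu - hu <= x1).
  { apply Rnot_lt_le; intro Hlt; specialize (H1' _ Hlt); lra. }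
  assert (x1 <= x2).
  { apply Rnot_lt_le; intro Hlt; specialize (H2' _ Hlt); lra. }
  assert (x2 <= xl - hl).
  { apply Rnot_lt_le; intro Hlt; specialize (Hm (xl - hl) x2 ltac:(lra)); lra. }
  assert (ek * (xu - hu) <= ek * x1) by (apply Rmult_le_compat_l; lra).
  assert (ek * x1 <= ek * x2) by (apply Rmult_le_compat_l; lra).
  assert (ek * x2 <= ek * (xl - hl)) by (apply Rmult_le_compat_l; lra).
  exists (f, (x1, x2)); cbn [fst snd].
  refine (conj Hf (conj Hfix (conj (conj H1 H1') (conj (conj H2 H2') (conj _ (conj _ _))))));
    rewrite <- ?Hhl, <- ?Hhu; lra. }
destruct (functional_choice _ Hk) as [F HF]; clear Hk.
set (f := fun k => fst (F k)); set (x1 := fun k => fst (snd (F k)));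
  set (x2 := fun k => snd (snd (F k))).
assert (Hrange : forall k, e k * (xu - du) - du <= e k * x1 k /\
  e k * x1 k <= e k * x2 k /\ e k * x2 k <= e k * (xl - dl) - dl).
{ intro k; destruct (HF k) as (_ & _ & _ & _ & H1 & H2 & H3).
  fold (x1 k) in H1, H2; fold (x2 k) in H2, H3; lra. }
set (B := Rabs (xu - du) + Rabs du + (Rabs (xl - dl) + Rabs dl)).
assert (HB : forall k p, - Rabs p <= e k * p <= Rabs p).
{ intros k p; specialize (He k); pose proof (Rle_abs p); pose proof (Rle_abs (- p)) as Hp.
  rewrite Rabs_Ropp in Hp; pose proof (Rabs_pos p); nra. }
assert (Hbound : forall k, - B <= e k * x1 k <= B /\ - B <= e k * x2 k <= B).
{ intro k; specialize (Hrange k).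
  pose proof (HB k (xu - du)); pose proof (HB k (xl - dl)).
  pose proof (Rle_abs du); pose proof (Rle_abs dl); pose proof (Rle_abs (- du)) as Hu;
  pose proof (Rle_abs (- dl)) as Hl; rewrite Rabs_Ropp in Hu, Hl; unfold B; lra. }
destruct (bounded_convergent_subseq (fun k => e k * x1 k) (- B) B) as (s & Hs & l1 & L1).
{ intro k; apply Hbound. }
destruct (bounded_convergent_subseq (fun k => e (s k) * x2 (s k)) (- B) B) as (r & Hr & l2 & L2).
{ intro k; apply Hbound. }
apply (Un_cv_subseq _ _ r Hr) in L1.
assert (Hsr : forall k, (k <= s (r k))%nat) by (intro k; specialize (Hr k); specialize (Hs (r k)); lia).
assert (Lsr := Un_cv_subseq _ _ _ Hsr Le).
destruct (recentered_limit P (fun k => f (s (r k))) (fun k => x1 (s (r k)))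
  (fun k => e (s (r k))) b1 (- l1)) as (f1 & Hf1); trivial.
{ intro k; apply HF. } { intro k; apply He. } { rewrite Ropp_involutive; exact L1. }
{ intro k; apply HF. } { intro k; apply HF. }
destruct (recentered_limit P (fun k => f (s (r k))) (fun k => x2 (s (r k)))
  (fun k => e (s (r k))) b2 (- l2)) as (f2 & Hf2); trivial.
{ intro k; apply HF. } { intro k; apply He. } { rewrite Ropp_involutive; exact L2. }
{ intro k; apply HF. } { intro k; apply HF. }
exists (- l1), (- l2), f1, f2.
assert (l2 <= - dl).
{ apply Rle_cv_lim with (2 := L2) (3 := Un_cv_affine _ (xl - dl) (- dl) Lsr).
  intro k; apply Hrange. }
assert (- du <= l1).
{ apply Rle_cv_lim with (2 := Un_cv_affine _ (xu - du) (- du) Lsr) (3 := L1).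
  intro k; apply Hrange. }
assert (l1 <= l2).
{ apply Rle_cv_lim with (2 := L1) (3 := L2); intro k; apply Hrange. }
refine (conj _ (conj _ (conj _ (conj Hf1 Hf2)))); lra.
Qed.

(** * Limits of waves at infinity *)

Lemma lim_pinf_inM u : inM u -> exists g, lim_pinf u g /\ 0 <= g <= 1 /\ forall x, u x <= g.
Proof.
intros Hu; destruct (completeness (fun z => exists x, z = u x)) as [g [Hub Hlub]].
- exists 1; intros z [x ->]; apply Hu.
- exists (u 0), 0; reflexivity.
- assert (Hx : forall x, u x <= g) by (intro x; apply Hub; exists x; reflexivity).
  exists g; split; [|split; [split|exact Hx]].
  + intros e He.
    assert (Hn : exists x, g - e < u x).
    { apply Classical_Prop.NNPP; intro Hn; assert (g <= g - e); [|lra].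
      apply Hlub; intros z [x ->]; apply Rnot_lt_le; intro; apply Hn; exists x; assumption. }
    destruct Hn as [A HA]; exists A; intros x HAx.
    pose proof (inM_nondecreasing _ Hu A x ltac:(lra)); specialize (Hx x).
    apply Rabs_def1; lra.
  + apply Rle_trans with (u 0); [apply Hu|apply Hx].
  + apply Hlub; intros z [x ->]; apply Hu.
Qed.

Lemma lim_minf_inM u : inM u -> exists g, lim_minf u g /\ 0 <= g <= 1 /\ forall x, g <= u x.
Proof.
intros Hu; destruct (completeness (fun z => exists x, z = - u x)) as [g [Hub Hlub]].
- exists 0; intros z [x ->]; destruct (proj1 Hu x); lra.
- exists (- u 0), 0; reflexivity.
- assert (Hx : forall x, - g <= u x).
  { intro x; specialize (Hub (- u x) (ex_intro _ x eq_refl)); lra. }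
  exists (- g); split; [|split; [split|exact Hx]].
  + intros e He.
    assert (Hn : exists x, u x < - g + e).
    { apply Classical_Prop.NNPP; intro Hn; assert (g <= g - e); [|lra].
      apply Hlub; intros z [x ->]; apply Rnot_lt_le; intro; apply Hn; exists x; lra. }
    destruct Hn as [A HA]; exists A; intros x HAx.
    pose proof (inM_nondecreasing _ Hu x A ltac:(lra)); specialize (Hx x).
    apply Rabs_def1; lra.
  + assert (g <= 0); [|lra].
    apply Hlub; intros z [x ->]; destruct (proj1 Hu x); lra.
  + apply Rle_trans with (u 0); [apply Hx|apply Hu].
Qed.

(** Translates of a wave are waves with the same displacement, and for a constant limit the wave
    equation is the fixed-point equation. *)
Lemma wave_translates_limit P u d s g : wave_map P -> inM u -> 0 <= g <= 1 ->
  (forall x, P u (x - d) = u x) -> wcv (fun k x => u (x + s k)) (cst g) ->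
  forall x, P (cst g) x = g.
Proof.
intros HP Hu Hg Hw Hcv x.
assert (E : P (cst g) (x + d - d) = cst g (x + d)).
{ apply wave_limit with (f := fun k y => u (y + s k)) (a := fun _ => 1) (b := fun _ => - d);
    auto using inM_shift, inM_cst, Un_cv_const; [intros; lra|].
  exists 0%nat; intros k _ y.
  rewrite <- (Hw (y + s k)); replace (y + s k - d) with (y + (s k - d)) by ring.
  rewrite <- wm_shift by assumption; f_equal; extensionality z; f_equal; ring. }
replace (x + d - d) with x in E by ring; exact E.
Qed.

Lemma wave_pinf_fixed P u d g : wave_map P -> inM u -> 0 <= g <= 1 ->
  (forall x, P u (x - d) = u x) -> lim_pinf u g -> forall x, P (cst g) x = g.
Proof.
intros HP Hu Hg Hw Hl; apply wave_translates_limit with (u := u) (d := d) (s := INR); trivial.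
intros x r e Hr He; destruct (Hl e He) as [A HA].
destruct (INR_archimed 1 (A - x)) as [K HK]; [lra|].
exists K; intros k Hk; specialize (HA (x + INR k)); apply le_INR in Hk.
specialize (HA ltac:(lra)); apply Rabs_def2 in HA; unfold cst; lra.
Qed.

Lemma wave_minf_fixed P u d g : wave_map P -> inM u -> 0 <= g <= 1 ->
  (forall x, P u (x - d) = u x) -> lim_minf u g -> forall x, P (cst g) x = g.
Proof.
intros HP Hu Hg Hw Hl.
apply wave_translates_limit with (u := u) (d := d) (s := fun k => - INR k); trivial.
intros x r e Hr He; destruct (Hl e He) as [A HA].
destruct (INR_archimed 1 (x - A)) as [K HK]; [lra|].
exists K; intros k Hk; specialize (HA (x + - INR k)); apply le_INR in Hk.
specialize (HA ltac:(lra)); apply Rabs_def2 in HA; unfold cst; lra.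
Qed.

(** * The semigroup *)

Record wave_semigroup (Q : R -> (R -> R) -> R -> R) : Prop := {
  ws_inM : forall t u, 0 <= t -> inM u -> inM (Q t u);
  ws_map : forall t, 0 < t -> wave_map (Q t);
  ws_add : forall t s, 0 <= t -> 0 <= s -> forall u, inM u ->
    forall x, Q t (Q s u) x = Q (t + s) u x;
  ws_cont0 : forall (tk : nat -> R) u, (forall k, 0 <= tk k) -> Un_cv tk 0 -> inM u ->
    cv_ae (fun k => Q (tk k) u) u }.

Lemma ws_wcv0 Q tk u : wave_semigroup Q -> (forall k, 0 <= tk k) -> Un_cv tk 0 -> inM u ->
  wcv (fun k => Q (tk k) u) u.
Proof.
intros HQ Htk Hcv Hu; apply cv_ae_wcv.
- intro k; apply inM_nondecreasing, ws_inM; auto.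
- apply inM_nondecreasing, Hu.
- apply ws_cont0; assumption.
Qed.

(** Continuity at 0 along the constant sequence of times 0 makes [u] a weak limit of [Q 0 u]. *)
Lemma ws_zero Q u : wave_semigroup Q -> inM u -> Q 0 u = u.
Proof.
intros HQ Hu.
assert (H0 : inM (Q 0 u)) by (apply ws_inM; auto; lra).
apply (wcv_unique (fun _ => Q 0 u)); trivial.
- apply wcv_const; [apply inM_nondecreasing, H0|auto].
- apply (ws_wcv0 Q (fun _ => 0)); auto using Un_cv_const; intros; lra.
Qed.

Lemma ws_shift Q t u b x : wave_semigroup Q -> 0 <= t -> inM u ->
  Q t (fun y => u (y + b)) x = Q t u (x + b).
Proof.
intros HQ [Ht | <-] Hu; [apply wm_shift; [apply ws_map|]; assumption|].
rewrite !ws_zero; trivial; apply inM_shift, Hu.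
Qed.

Lemma ws_wave_iterate Q tau c u m : wave_semigroup Q -> 0 <= tau -> inM u ->
  (forall x, Q tau u (x - c * tau) = u x) ->
  forall x, Q (INR m * tau) u (x - c * (INR m * tau)) = u x.
Proof.
intros HQ Ht Hu Hw; induction m as [|m IH]; intro x.
- change (INR 0) with 0; rewrite Rmult_0_l, ws_zero by assumption; f_equal; ring.
- assert (Hm : 0 <= INR m * tau) by (apply Rmult_le_pos; [apply pos_INR|exact Ht]).
  rewrite S_INR; replace ((INR m + 1) * tau) with (tau + INR m * tau) by ring.
  rewrite <- ws_add by assumption.
  replace (Q (INR m * tau) u) with (fun y => u (y + c * (INR m * tau))).
  + rewrite ws_shift, <- (Hw x) by assumption; f_equal; ring.
  + extensionality y; rewrite <- IH; f_equal; ring.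
Qed.

Lemma floor_multiple tau t : 0 < tau -> 0 <= t ->
  exists m, INR m * tau <= t < INR m * tau + tau.
Proof.
intros Htau Ht; destruct (INR_archimed tau t Htau) as [n Hn].
induction n as [|n IH]; [simpl in Hn; lra|].
rewrite S_INR in Hn.
destruct (Rlt_dec t (INR n * tau)) as [Hlt|Hlt]; [apply IH; lra|exists n; lra].
Qed.

(** Iteration makes [f k] a wave for every multiple of its time step, so each fixed dyadic time is
    eventually covered and its equation passes to the limit. A general time is a dyadic one plus a
    small remainder, treated by continuity at 0. *)
Lemma ws_dyadic_waves_limit Q c f s c0 b : wave_semigroup Q -> (forall k, (k <= s k)%nat) ->
  Un_cv c c0 -> (forall k, inM (f k)) -> (forall k, crosses b (f k)) ->
  (forall k x, Q (1 / 2 ^ s k) (f k) (x - c k * (1 / 2 ^ s k)) = f k x) ->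
  exists g, inM g /\ crosses b g /\ forall t, 0 <= t -> forall x, Q t g (x - c0 * t) = g x.
Proof.
intros HQ Hs Hc Hf Hb Hw.
destruct (helly f Hf) as (r & g & Hr & Hg & Hcv).
assert (Hpow : forall n, 0 < 2 ^ n) by (intro; apply pow_lt; lra).
assert (Htau : forall n, 0 < 1 / 2 ^ n) by (intro; apply Rdiv_lt_0_compat; [lra|apply Hpow]).
assert (Hdy : forall m n x, Q (INR m * (1 / 2 ^ n)) g (x - c0 * (INR m * (1 / 2 ^ n))) = g x).
{ intros m n x; set (t := INR m * (1 / 2 ^ n)).
  assert (Ht : 0 <= t) by (apply Rmult_le_pos; [apply pos_INR|apply Rlt_le, Htau]).
  destruct Ht as [Ht | <-].
  2:{ rewrite ws_zero by assumption; f_equal; ring. }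
  apply wave_limit with (f := fun k => f (r k)) (a := fun _ => 1)
    (b := fun k => - (c (r k) * t)); auto using Un_cv_const, ws_map.
  - intros; lra.
  - apply CV_opp, CV_mult; [|apply Un_cv_const]; apply Un_cv_subseq; assumption.
  - exists n; intros k Hk y; specialize (Hr k); specialize (Hs (r k)).
    set (N := s (r k)) in *.
    assert (Et : t = INR (m * 2 ^ (N - n)) * (1 / 2 ^ N)).
    { unfold t; rewrite mult_INR, pow_INR; change (INR 2) with 2.
      replace (2 ^ N) with (2 ^ n * 2 ^ (N - n)) by (rewrite <- pow_add; f_equal; lia).
      field; split; apply Rgt_not_eq, Hpow. }
    pose proof (ws_wave_iterate Q (1 / 2 ^ N) (c (r k)) (f (r k)) (m * 2 ^ (N - n)) HQ
      (Rlt_le _ _ (Htau N)) (Hf _) (Hw (r k)) y) as E.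
    rewrite <- Et in E; rewrite <- E; change (y - c (r k) * t) with (y + - (c (r k) * t)).
    rewrite <- ws_shift by (trivial; lra); f_equal; extensionality z; f_equal; ring. }
exists g; split; [exact Hg|split; [apply crosses_wcv with (2 := Hcv); auto|]].
intros t Ht x.
enough (E : Q t g = fun y => g (y + c0 * t)) by (rewrite E; f_equal; ring).
destruct (functional_choice (fun k m => INR m * (1 / 2 ^ k) <= t < INR m * (1 / 2 ^ k) + 1 / 2 ^ k))
  as [m Hm]; [intro k; apply floor_multiple; auto|].
set (q := fun k => t - INR (m k) * (1 / 2 ^ k)).
assert (Hq0 : forall k, 0 <= q k) by (intro k; specialize (Hm k); unfold q; lra).
assert (Hq : Un_cv q 0).
{ intros e He; destruct (cv_pow_half 1 e He) as [K HK]; exists K; intros k Hk.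
  specialize (HK k Hk); apply Rabs_def2 in HK; specialize (Hm k); unfold q.
  apply Rabs_def1; lra. }
assert (HM : inM (Q t g)) by (apply ws_inM; assumption).
apply (wcv_unique (fun _ => Q t g)); trivial; [apply inM_shift, Hg|..].
- apply wcv_const; [apply inM_nondecreasing, HM|auto].
(* Split [t] into the remainder [q k] and a dyadic time: [Q] at the dyadic time only translates [g]
   by [c0 * (t - q k)], and [Q (q k) g] tends to [g]. *)
- apply wcv_eventually with (f := fun k y => Q (q k) g (y + c0 * (t - q k))).
  + exists 0%nat; intros k _ y.
    assert (0 <= INR (m k) * (1 / 2 ^ k)) by (apply Rmult_le_pos; [apply pos_INR|apply Rlt_le, Htau]).
    replace t with (q k + INR (m k) * (1 / 2 ^ k)) at 1 by (unfold q; ring).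
    rewrite <- ws_add, <- ws_shift by auto; f_equal; extensionality z.
    rewrite <- (Hdy (m k) k (z + c0 * (t - q k))); f_equal; unfold q; ring.
  + apply wcv_perturb with (f := fun k => Q (q k) g) (g := g) (a := c0 * t)
      (p := fun k y => y + c0 * (t - q k)).
    * intro k; apply inM_nondecreasing, ws_inM; auto.
    * intro y; apply CV_plus; [apply Un_cv_const|]; apply CV_mult; [apply Un_cv_const|].
      pose proof (CV_minus _ _ _ _ (Un_cv_const t) Hq) as L; rewrite Rminus_0_r in L; exact L.
    * apply ws_wcv0; assumption.
Qed.

(** The bounds [cl <= c2 <= c1 <= cu] do not depend on the time step, so both speeds converge along
    a common extraction as the step tends to 0. *)
Lemma ws_two_waves Q v w cl cu b1 b2 xl xu : wave_semigroup Q -> inM v -> inM w ->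
  v 0 = 0 -> w 0 = 1 -> b1 <= b2 -> b2 < v xl -> w xu <= b1 -> cl <= cu ->
  (forall t, 0 <= t -> forall x, v x <= Q t v (x - cl * t)) ->
  (forall t, 0 <= t -> forall x, Q t w (x - cu * t) <= w x) ->
  exists c1 c2 f1 f2, cl <= c2 /\ c2 <= c1 /\ c1 <= cu /\
    (inM f1 /\ crosses b1 f1 /\ forall t, 0 <= t -> forall x, Q t f1 (x - c1 * t) = f1 x) /\
    (inM f2 /\ crosses b2 f2 /\ forall t, 0 <= t -> forall x, Q t f2 (x - c2 * t) = f2 x).
Proof.
intros HQ Hv Hw V0 W0 Hb Hxl Hxu Hc Hsub Hsup.
assert (Htau : forall n, 0 < 1 / 2 ^ n).
{ intro; apply Rdiv_lt_0_compat; [lra|apply pow_lt; lra]. }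
destruct (functional_choice (fun n (p : (R * (R -> R)) * (R * (R -> R))) =>
  (cl <= fst (snd p) /\ fst (snd p) <= fst (fst p) /\ fst (fst p) <= cu) /\
  (inM (snd (fst p)) /\ crosses b1 (snd (fst p)) /\
    forall x, Q (1 / 2 ^ n) (snd (fst p)) (x - fst (fst p) * (1 / 2 ^ n)) = snd (fst p) x) /\
  (inM (snd (snd p)) /\ crosses b2 (snd (snd p)) /\
    forall x, Q (1 / 2 ^ n) (snd (snd p)) (x - fst (snd p) * (1 / 2 ^ n)) = snd (snd p) x)))
  as [F HF].
{ intro n; specialize (Htau n); set (tau := 1 / 2 ^ n) in *.
  destruct (two_waves (Q tau) v w (cl * tau) (cu * tau) b1 b2 xl xu)
    as (d1 & d2 & f1 & f2 & H1 & H2 & H3 & Hf1 & Hf2); auto using ws_map; try lra.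
  { apply Rmult_le_compat_r; lra. }
  { apply Hsub; lra. } { apply Hsup; lra. }
  assert (Ed : forall d, d / tau * tau = d) by (intro; field; lra).
  exists ((d1 / tau, f1), (d2 / tau, f2)); cbn [fst snd]; rewrite !Ed.
  refine (conj (conj _ (conj _ _)) (conj Hf1 Hf2));
    apply (Rmult_le_reg_r tau); trivial; rewrite ?Ed; trivial. }
set (c1 := fun n => fst (fst (F n))); set (c2 := fun n => fst (snd (F n))).
assert (Hrange : forall n, cl <= c2 n /\ c2 n <= c1 n /\ c1 n <= cu) by (intro n; apply HF).
destruct (bounded_convergent_subseq c1 cl cu) as (s & Hs & l1 & L1).
{ intro n; specialize (Hrange n); lra. }
destruct (bounded_convergent_subseq (fun n => c2 (s n)) cl cu) as (r & Hr & l2 & L2).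
{ intro n; specialize (Hrange (s n)); lra. }
apply (Un_cv_subseq _ _ r Hr) in L1.
assert (Hsr : forall n, (n <= s (r n))%nat) by (intro n; specialize (Hr n); specialize (Hs (r n)); lia).
destruct (ws_dyadic_waves_limit Q (fun n => c1 (s (r n))) (fun n => snd (fst (F (s (r n)))))
  (fun n => s (r n)) l1 b1) as (f1 & Hf1); trivial; try (intro n; apply HF).
destruct (ws_dyadic_waves_limit Q (fun n => c2 (s (r n))) (fun n => snd (snd (F (s (r n)))))
  (fun n => s (r n)) l2 b2) as (f2 & Hf2); trivial; try (intro n; apply HF).
exists l1, l2, f1, f2; refine (conj _ (conj _ (conj _ (conj Hf1 Hf2)))).
- apply Rle_cv_lim with (2 := Un_cv_const cl) (3 := L2); intro n; apply Hrange.
- apply Rle_cv_lim with (2 := L2) (3 := L1); intro n; apply Hrange.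
- apply Rle_cv_lim with (2 := L1) (3 := Un_cv_const cu); intro n; apply Hrange.
Qed.

(** If [cu < cl], the chain [v xl <= Q t v (xl - cl * t) <= Q t w (xl - cl * t) <= w (xl - (cl - cu)
    * t)] bounds [v xl] by values of [w] ever farther left, eventually below [a]. *)
Lemma ws_speed_le Q v w cl cu a xl : wave_semigroup Q -> inM v -> inM w ->
  (forall x, v x <= w x) -> a < v xl -> (exists l, lim_minf w l /\ l < a) ->
  (forall t, 0 <= t -> forall x, v x <= Q t v (x - cl * t)) ->
  (forall t, 0 <= t -> forall x, Q t w (x - cu * t) <= w x) ->
  cl <= cu.
Proof.
intros HQ Hv Hw Hvw Hxl (l & Hl & Hla) Hsub Hsup.
apply Rnot_lt_le; intro Hlt.
destruct (Hl (a - l)) as [A HA]; [lra|].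
(* The quotient pushes the argument of [w] below [A]; the lower bound 1 keeps [t] positive, as
   comparison requires. *)
set (t := Rmax 1 ((xl - A + 1) / (cl - cu))).
assert (Ht : 1 <= t) by apply Rmax_l.
assert (Ht' : xl - A + 1 <= t * (cl - cu)).
{ replace (xl - A + 1) with ((xl - A + 1) / (cl - cu) * (cl - cu)) by (field; lra).
  apply Rmult_le_compat_r; [lra|apply Rmax_r]. }
specialize (HA (xl - (cl - cu) * t) ltac:(lra)); apply Rabs_def2 in HA.
pose proof (Hsub t ltac:(lra) xl) as H1.
pose proof (Hsup t ltac:(lra) (xl - (cl - cu) * t)) as H2.
replace (xl - (cl - cu) * t - cu * t) with (xl - cl * t) in H2 by ring.
pose proof (wm_mono _ (ws_map Q HQ t ltac:(lra)) v w Hv Hw Hvw (xl - cl * t)); lra.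
Qed.

Theorem theorem8
  (alpha : R) (Q : R -> (R -> R) -> (R -> R))
  (Halpha : 0 < alpha < 1)
  (HQM : forall t u, 0 <= t -> inM u -> inM (Q t u))
  (* (i) *)
  (Hi : forall t, 0 < t -> forall (uk : nat -> R -> R) (u : R -> R),
      (forall k, inM (uk k)) -> inM u -> cv_loc_unif uk u ->
      cv_ae (fun k => Q t (uk k)) (Q t u))
  (* (ii) *)
  (Hii : forall t, 0 < t -> forall u1 u2, inM u1 -> inM u2 ->
      (forall x, u1 x <= u2 x) -> forall x, Q t u1 x <= Q t u2 x)
  (* (iii) *)
  (Hiii : forall t, 0 < t -> forall x0 u, inM u ->
      forall x, Q t (transl x0 u) x = transl x0 (Q t u) x)
  (* (iv) *)
  (Hiv1 : forall t, 0 < t -> forall x, Q t (cst alpha) x = alpha)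
  (Hiv2 : forall t, 0 < t -> forall g, 0 < g < alpha -> forall x, Q t (cst g) x < g)
  (Hiv3 : forall t, 0 < t -> forall g, alpha < g < 1 -> forall x, g < Q t (cst g) x)
  (* (a) semigroup *)
  (Ha : forall t s, 0 <= t -> 0 <= s -> forall u, inM u ->
      forall x, Q t (Q s u) x = Q (t + s) u x)
  (* (b) continuity at t = 0 *)
  (Hb : forall (tk : nat -> R) u, (forall k, 0 <= tk k) -> Un_cv tk 0 -> inM u ->
      cv_ae (fun k => Q (tk k) u) u)
  (* (c) ordering of the speeds of the partial waves *)
  (Hc : forall cm cp phim phip, inM phim -> inM phip ->
      lim_minf phim 0 -> lim_pinf phim alpha ->
      lim_minf phip alpha -> lim_pinf phip 1 ->
      (forall t, 0 <= t -> forall x, Q t phim (x - cm * t) = phim x) ->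
      (forall t, 0 <= t -> forall x, Q t phip (x - cp * t) = phip x) ->
      cm < cp)
  (* sub-solution *)
  (cl : R) (psil : R -> R) (Hpsil : inM psil) (Hpsil0 : psil 0 = 0)
  (Hpsilinf : exists l, lim_pinf psil l /\ alpha < l <= 1)
  (Hsub : forall t, 0 <= t -> forall x, psil x <= Q t psil (x - cl * t))
  (* super-solution *)
  (cu : R) (psiu : R -> R) (Hpsiu : inM psiu) (Hpsiu0 : psiu 0 = 1)
  (Hpsiuinf : exists l, lim_minf psiu l /\ 0 <= l < alpha)
  (Hsup : forall t, 0 <= t -> forall x, Q t psiu (x - cu * t) <= psiu x) :
  exists c phi, cl <= c <= cu /\ inM phi /\ lim_minf phi 0 /\ lim_pinf phi 1 /\
    forall t, 0 <= t -> forall x, Q t phi (x - c * t) = phi x.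
Proof.
pose proof (HQ := Build_wave_semigroup Q HQM (fun t Ht => Build_wave_map (Q t)
  (fun u => HQM t u (Rlt_le _ _ Ht)) (Hi t Ht) (Hii t Ht) (Hiii t Ht)) Ha Hb).
destruct Hpsilinf as (l & Hl & Hl1); destruct Hpsiuinf as (l' & Hl' & Hl1').
(* Each level lies strictly between two fixed constants, and the barriers still cross it: [psiu]
   falls below [b1] and [psil] exceeds [b2]. *)
set (b1 := (l' + alpha) / 2); set (b2 := (alpha + l) / 2).
assert (Hb1 : 0 < b1 < alpha /\ l' < b1) by (unfold b1; lra).
assert (Hb2 : alpha < b2 < 1 /\ b2 < l) by (unfold b2; lra).
assert (Hxl : exists xl, b2 < psil xl).
{ destruct (Hl (l - b2)) as [A HA]; [lra|]; exists (A + 1).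
  specialize (HA (A + 1) ltac:(lra)); apply Rabs_def2 in HA; lra. }
assert (Hxu : exists xu, psiu xu <= b1).
{ destruct (Hl' (b1 - l')) as [A HA]; [lra|]; exists (A - 1).
  specialize (HA (A - 1) ltac:(lra)); apply Rabs_def2 in HA; lra. }
destruct Hxl as [xl Hxl]; destruct Hxu as [xu Hxu].
assert (Hle : forall x, psil x <= psiu x).
{ intro x; destruct (Rle_dec x 0) as [Hx|Hx].
  - apply Rle_trans with (psil 0); [apply inM_nondecreasing; assumption|].
    rewrite Hpsil0; apply Hpsiu.
  - apply Rle_trans with (psiu 0); [rewrite Hpsiu0; apply Hpsil|].
    apply inM_nondecreasing; [assumption|lra]. }
assert (Hcc : cl <= cu).
{ apply (ws_speed_le Q psil psiu cl cu alpha xl); trivial; [lra|exists l'; split; [trivial|lra]]. }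
destruct (ws_two_waves Q psil psiu cl cu b1 b2 xl xu)
  as (c1 & c2 & f1 & f2 & H1 & H2 & H3 & (M1 & X1 & W1) & (M2 & X2 & W2)); trivial; [lra|].
assert (Hfix : forall g, 0 <= g <= 1 -> (forall x, Q 1 (cst g) x = g) ->
  g = 0 \/ g = alpha \/ g = 1).
{ intros g Hg E; specialize (E 0).
  destruct (Rtotal_order g alpha) as [Hlt|[->|Hgt]]; [|auto|].
  - left; apply Rle_antisym; [|lra]; apply Rnot_lt_le; intro.
    pose proof (Hiv2 1 Rlt_0_1 g ltac:(lra) 0); lra.
  - right; right; apply Rle_antisym; [lra|]; apply Rnot_lt_le; intro.
    pose proof (Hiv3 1 Rlt_0_1 g ltac:(lra) 0); lra. }
pose proof (ws_map Q HQ 1 Rlt_0_1) as HP.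
destruct (lim_minf_inM f1 M1) as (m1 & Lm1 & B1 & I1).
destruct (lim_pinf_inM f1 M1) as (p1 & Lp1 & B1' & S1).
destruct (lim_minf_inM f2 M2) as (m2 & Lm2 & B2 & I2).
destruct (lim_pinf_inM f2 M2) as (p2 & Lp2 & B2' & S2).
pose proof (Hfix m1 B1 (wave_minf_fixed _ _ _ _ HP M1 B1 (W1 1 Rle_0_1) Lm1)).
pose proof (Hfix p1 B1' (wave_pinf_fixed _ _ _ _ HP M1 B1' (W1 1 Rle_0_1) Lp1)) as Fp1.
pose proof (Hfix m2 B2 (wave_minf_fixed _ _ _ _ HP M2 B2 (W2 1 Rle_0_1) Lm2)) as Fm2.
pose proof (Hfix p2 B2' (wave_pinf_fixed _ _ _ _ HP M2 B2' (W2 1 Rle_0_1) Lp2)).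
destruct X1 as [X1 X1']; specialize (X1 (-1) ltac:(lra)); specialize (X1' 1 ltac:(lra)).
destruct X2 as [X2 X2']; specialize (X2 (-1) ltac:(lra)); specialize (X2' 1 ltac:(lra)).
specialize (I1 (-1)); specialize (S1 1); specialize (I2 (-1)); specialize (S2 1).
(* From [m1 <= b1 < alpha] and [alpha < b2 <= p2], only the outer constants remain. Likewise
   [b1 <= p1] excludes [p1 = 0] and [m2 <= b2] excludes [m2 = 1]. *)
assert (m1 = 0) by lra; assert (p2 = 1) by lra; subst m1 p2.
destruct Fp1 as [Fp1|[Fp1|Fp1]]; [lra| |].
2:{ subst p1; exists c1, f1; split; [lra|auto]. }
destruct Fm2 as [Fm2|[Fm2|Fm2]]; [| |lra].
{ subst m2; exists c2, f2; split; [lra|auto]. }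
(* Here [f1] joins 0 to [alpha] and [f2] joins [alpha] to 1, so (c) gives [c1 < c2], against
   [c2 <= c1]. *)
subst p1 m2; pose proof (Hc c1 c2 f1 f2 M1 M2 Lm1 Lp1 Lm2 Lp2 W1 W2); lra.
Qed.
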